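(* Let $G=(V,E)$ be a finite graph (without loops) with $V=\{1,\dots,n\}$, and let $\mathcal C$ be a storage code on $G$ over a finite alphabet $Q$, $|Q|=q\ge 2$, with $\mathcal R_q(\mathcal C)=\mathsf{cap}_q(G)$. Fix a proper coloring of $G$ and, for each color, a matrix from a family of orthogonal partitions of shape $(k,s)$ (distinct colors receiving distinct matrices), and let $\bar G$ and $\bar{\mathcal C}$ be the resulting interleaved graph and interleaved code. If $\mathsf{cap}_q(G)$ achieves the LP bound, i.e. $\mathsf{cap}_q(G)=\mathrm{LP}_\tau(G)$ for some integer $\tau>0$, then the interleaved code $\bar{\mathcal C}$ has the maximum possible rate on $\bar G$, i.e. $\mathcal R_{q^k}(\bar{\mathcal C})=\mathsf{cap}(\bar G)$, and $\mathsf{cap}_{q^k}(\bar G)=\mathsf{cap}(G)$.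
   Context: Storage codes: for a finite graph $G=(V,E)$ with $|V|=n$ put $N(v)=\{u:(v,u)\in E\}$. A storage code on $G$ over an alphabet $Q$ of size $q$ is a nonempty set $\mathcal C\subseteq Q^V$ such that for each $v\in V$ there is a function $f_v$ with $x_v=f_v((x_u)_{u\in N(v)})$ for all $x\in\mathcal C$. Its rate is $\mathcal R_q(\mathcal C)=\frac1n\log_q|\mathcal C|$; $\mathsf{cap}_q(G)$ is the largest rate of a storage code on $G$ over an alphabet of size $q$, and $\mathsf{cap}(G)=\sup_{q\ge2}\mathsf{cap}_q(G)$. LP bound (Mazumdar, McGregor, Vorotnikova): for $A\subseteq V$ let $\mathrm{cl}(A)=A\cup\{v: N(v)\subseteq A\}$. Fix an integer $\tau>0$ and a set of $\tau$ colors. A gadget $g=(S_1,S_2,c_1,c_2)$ is given by sets $A,B\subseteq V$ with $S_1=\mathrm{cl}(A)\cup \mathrm{cl}(B)$ (the outside) and $S_2=\mathrm{cl}(A)\cap \mathrm{cl}(B)$ (the inside), and two of the $\tau$ colors $c_1,c_2$, assigned to all vertices of $S_1$ and of $S_2$, respectively; its weight is $w(g)=|A|+|B|$. Trivial gadgets $(\{v\},\emptyset,c_1,c_2)$, $v\in V$, of weight $1$, are also allowed. Write $c_g(S_i)=c_i$. For every gadget $g$ and each of its two parts $S\in\{S_1,S_2\}$ there is a $0/1$ variable $\chi_{g,S}$ indicating whether $g$ is involved in the cover. $\mathrm{LP}_\tau(G)$ is the minimum of $$\frac1{n\tau}\sum_{g,S}\chi_{g,S}\frac{w(g)}2$$ subject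 to: $\frac1\tau\sum_{g,S}\chi_{g,S}\frac{w(g)}2\in\mathbb N$; for every edge $(u,v)\in E$ and every color $c$, $\sum_{g,S:\,u\in S,\,c_g(S)=c}\chi_{g,S}+\sum_{g',S':\,v\in S',\,c_{g'}(S')=c}\chi_{g',S'}\ge 1$; and $\chi_{g,S_1}=\chi_{g,S_2}$ for every gadget $g$ with outside $S_1$ and inside $S_2$. (The known theorem is that $\mathsf{cap}(G)\le \mathrm{LP}_\tau(G)$.) Orthogonal partitions: let $s\ge k\ge 1$. A set $\mathcal M$ of $k\times s$ matrices over $\mathbb N$ is a family of orthogonal partitions of $\{1,\dots,ks\}$ of shape $(k,s)$ if (1) every $A\in\mathcal M$ contains every element of $\{1,\dots,ks\}$ exactly once; (2) for all distinct $A,B\in\mathcal M$, every column of $A$ has common entries with exactly $k$ columns of $B$, and every such pair of intersecting columns has exactly one common element. Interleaved graph: fix a coloring $c(\cdot)$ of $V$ with colors $1,\dots,c$ such that adjacent vertices have different colors, and distinct matrices $M_1,\dots,M_c\in\mathcal M$. The graph $\bar G=(\bar V,\bar E)$ has $\bar V=\{1,\dots,n\}\times\{1,\dots,s\}$ and $((t,\mu),(t',\mu'))\in\bar E$ if and only if $(t,t')\in E$ and column $\mu$ of $M_{c(t)}$ intersects column $\mu'$ of $M_{c(t')}$ (as sets of entries). Interleaved code: for any (not necessarily distinct) $x^1,\dots,x^{ks}\in\mathcal C$, let $\bar x\in (Q^k)^{\bar V}$ be the word that assigns to the vertex $(t,\mu)$ the vector $\bigl(x_t^{M_{c(t)}(1,\mu)},\dots,x_t^{M_{c(t)}(k,\mu)}\bigr)\in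 Q^k$. The code $\bar{\mathcal C}$ (over the alphabet $Q^k$) is the set of all words $\bar x$ obtained as $(x^1,\dots,x^{ks})$ ranges over $\mathcal C^{ks}$. *)

(* Defs.v *)
From HB Require Import structures.
From mathcomp Require Import all_boot all_order all_algebra.
From mathcomp Require Import all_classical all_reals all_analysis.

Set Implicit Arguments.
Unset Strict Implicit.
Unset Printing Implicit Defensive.

Import Order.TTheory GRing.Theory Num.Theory.
Local Open Scope ring_scope.

(* A graph on a finite vertex type V is its edge relation e : rel V, where
   e v u stands for (v, u) \in E.  Symmetry is never needed: an undirected
   graph is a symmetric e. *)

Definition nbr (V : finType) (e : rel V) (v : V) : {set V} :=
  [set u | e v u]%SET.

(* The recovery function of v has access only to the restriction of the
   codeword to N(v). *)
Definition storage_code (V Q : finType) (e : rel V) (C : {set {ffun V -> Q}}) :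
    Prop :=
  C != finset.set0 /\
  forall v : V, exists f : {ffun {u : V | u \in nbr e v} -> Q} -> Q,
    forall x : {ffun V -> Q}, x \in C -> x v = f [ffun u => x (val u)].

(* The base q is the alphabet size #|Q|; it is a separate argument so that it
   can be written as a power. *)
Definition rate (R : realType) (q : nat) (V Q : finType)
    (C : {set {ffun V -> Q}}) : R :=
  #|V|%:R^-1 * (ln #|C|%:R / ln q%:R).

(* For q > 1 this set of rates is finite and nonempty (the possible values
   of #|C| range over 1, ..., q ^ #|V|), so the supremum is a maximum. *)
Definition cap_q (R : realType) (V : finType) (e : rel V) (q : nat) : R :=
  sup [set r : R | exists (Q : finType) (C : {set {ffun V -> Q}}),
    [/\ #|Q| = q, storage_code e C & r = rate R q C]]%classic.

(* Rates are at most 1, so this supremum is that of a bounded set. *)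
Definition cap (R : realType) (V : finType) (e : rel V) : R :=
  sup [set cap_q R e q | q in [set q : nat | (2 <= q)%N]]%classic.

Definition cl (V : finType) (e : rel V) (A : {set V}) : {set V} :=
  (A :|: [set v | nbr e v \subset A])%SET.

(* inl (A, B) is the gadget given by the sets A and B, inr v is the trivial
   gadget ({v}, set0); the last two components are the colors c1 and c2 of the
   outside and of the inside, which may coincide.  The weight depends on A and
   B and not only on the two parts, whence the indexing by A and B. *)
Definition gadget (V : finType) (tau : nat) : finType :=
  ((({set V} * {set V}) + V) * ('I_tau * 'I_tau))%type.

(* The part of index true is the outside S1, that of index false the
   inside S2. *)
Definition gpart (V : finType) (e : rel V) (tau : nat) (g : gadget V tau)
    (b : bool) : {set V} :=
  match g.1 with
  | inl (A, B) =>
      if b then (cl e A :|: cl e B)%SET else (cl e A :&: cl e B)%SET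
  | inr v => if b then [set v]%SET else finset.set0
  end.

Definition gcolor (V : finType) (tau : nat) (g : gadget V tau) (b : bool) :
    'I_tau :=
  if b then g.2.1 else g.2.2.

Definition gweight (V : finType) (tau : nat) (g : gadget V tau) : nat :=
  match g.1 with
  | inl (A, B) => #|A| + #|B|
  | inr _ => 1
  end.

Section LP.
Variables (R : realType) (V : finType) (e : rel V) (tau : nat).
Implicit Type chi : gadget V tau -> bool -> bool.

Definition lp_weight chi : R :=
  \sum_(g : gadget V tau) \sum_(b : bool)
    (chi g b)%:R * ((gweight g)%:R / 2).

Definition lp_cover (chi : gadget V tau -> bool -> bool) (u : V)
    (c : 'I_tau) : nat :=
  (\sum_(g : gadget V tau)
     \sum_(b : bool | (u \in gpart e g b) && (gcolor g b == c)) chi g b)%N.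

Definition lp_feasible chi : Prop :=
  [/\ tau%:R^-1 * lp_weight chi \is a Num.nat,
      forall u v : V, e u v -> forall c : 'I_tau,
        (1 <= lp_cover chi u c + lp_cover chi v c)%N
    & forall g : gadget V tau, chi g true = chi g false].

(* There are finitely many chi, and for tau > 0 the constant chi = true is
   feasible, so the infimum is a minimum. *)
Definition lp_bound : R :=
  inf [set (#|V|%:R * tau%:R)^-1 * lp_weight chi
        | chi in [set chi | lp_feasible chi]]%classic.

End LP.

Definition col_entries (k s : nat) (A : 'M[nat]_(k, s)) (j : 'I_s) : seq nat :=
  [seq A i j | i : 'I_k].

Definition cols_meet (k s : nat) (A B : 'M[nat]_(k, s)) (j j' : 'I_s) : bool :=
  has (mem (col_entries B j')) (col_entries A j).

Definition orthogonal_partitions (k s : nat) (F : set 'M[nat]_(k, s)) : Prop :=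
  (forall A, F A -> forall m : nat, (1 <= m <= k * s)%N ->
     exists! p : 'I_k * 'I_s, A p.1 p.2 = m) /\
  (forall A B, F A -> F B -> A <> B -> forall j : 'I_s,
     #|[set j' | cols_meet A B j j']%SET| = k /\
     forall j' : 'I_s, cols_meet A B j j' ->
       exists! m : nat, m \in col_entries A j /\ m \in col_entries B j').

Definition proper_coloring (V : finType) (e : rel V) (ncol : nat)
    (c : V -> 'I_ncol) : Prop :=
  forall u v : V, e u v -> c u != c v.

Definition interleaved_graph (V : finType) (e : rel V) (k s ncol : nat)
    (c : V -> 'I_ncol) (M : 'I_ncol -> 'M[nat]_(k, s)) : rel (V * 'I_s) :=
  fun p p' => e p.1 p'.1 && cols_meet (M (c p.1)) (M (c p'.1)) p.2 p'.2.

(* The family x^1, ..., x^{ks} is given by x : nat -> {ffun V -> Q}; only its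
   values on 1, ..., ks are used, these being the entries of the matrices. *)
Definition interleaved_word (V Q : finType) (k s ncol : nat)
    (c : V -> 'I_ncol) (M : 'I_ncol -> 'M[nat]_(k, s))
    (x : nat -> {ffun V -> Q}) : {ffun V * 'I_s -> {ffun 'I_k -> Q}} :=
  [ffun p => [ffun i => x (M (c p.1) i p.2) p.1]].

Definition interleaved_code (V Q : finType) (k s ncol : nat)
    (c : V -> 'I_ncol) (M : 'I_ncol -> 'M[nat]_(k, s))
    (C : {set {ffun V -> Q}}) : {set {ffun V * 'I_s -> {ffun 'I_k -> Q}}} :=
  [set y | `[< exists2 x : nat -> {ffun V -> Q},
                 forall m : nat, (1 <= m <= k * s)%N -> x m \in C
               & y = interleaved_word c M x >]]%SET.

(* Main.v *)
(* For a storage code, let H(S) be the Shannon entropy of the restriction to S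
   of a uniformly random codeword: H is submodular, H(cl A) = H(A) is at most
   |A| log q, and H(U) = log |C| when U is a vertex cover, since the vertices
   outside U are recovered from U.  Summing over the gadgets of a feasible cover
   gives the LP bound.  If p : W -> V is a graph homomorphism all of whose fibers
   have size m, then S |-> H(p^-1 S) has the same properties on V, with
   m log q in place of log q; so the LP bound of G bounds the rates of all storage
   codes on W.  The identity of G and the projection of the interleaved graph to G
   are two such homomorphisms, so the capacities of both graphs are at most
   LP_tau(G) = cap_q(G), the rate of C.  The interleaved code is a storage code,
   and it has at least |C|^(ks) words because every index in 1, ..., ks occurs in
   every matrix; hence its rate is at least that of C, and all these quantities
   coincide. *)

Require Import Defs.
From mathcomp Require Import all_boot all_order all_algebra.
From mathcomp Require Import all_classical all_reals all_analysis.
From mathcomp Require Import ring lra.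
Local Open Scope ring_scope.
Set Implicit Arguments.
Unset Strict Implicit.
Unset Printing Implicit Defensive.
Import Order.TTheory GRing.Theory Num.Theory.

(** * Entropy of restrictions of a random codeword *)

Section Entropy.
Variables (R : realType) (V Q : finType) (C : {set {ffun V -> Q}}).
Implicit Types (S T : {set V}) (x y z : {ffun V -> Q}).

Definition agree S x y := [forall v in S, x v == y v].

Lemma agreeP S x y : reflect {in S, x =1 y} (agree S x y).
Proof. by apply: (iffP forall_inP) => xy v /xy /eqP. Qed.

Lemma agree_refl S x : agree S x x.
Proof. exact/agreeP. Qed.

Lemma agree_sym S : symmetric (agree S).
Proof. by move=> x y; apply/agreeP/agreeP => xy v /xy. Qed.

Lemma agree_trans S : transitive (agree S).
Proof. by move=> y x z /agreeP xy /agreeP yz; apply/agreeP => v vS; rewrite xy ?yz. Qed.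

Lemma agreeU S T x y : agree (S :|: T) x y = agree S x y && agree T x y.
Proof.
apply/agreeP/andP => [xy|[/agreeP xS /agreeP xT] v].
  by split; apply/agreeP => v vS; apply: xy; rewrite inE vS ?orbT.
by rewrite inE => /orP[/xS|/xT].
Qed.

Lemma agree_sub S T x y : T \subset S -> agree S x y -> agree T x y.
Proof. by move=> /fintype.subsetP TS /agreeP xy; apply/agreeP => v /TS /xy. Qed.

Definition agree_card S x := #|[set y in C | agree S x y]|.

Lemma agree_cardE S x :
  (agree_card S x)%:R = \sum_(y in C) (agree S x y)%:R :> R.
Proof.
rewrite /agree_card -sum1_card natr_sum big_mkcond [RHS]big_mkcond /=.
by apply: eq_bigr => y _; rewrite inE; case: (y \in C); case: (agree S x y).
Qed.

Lemma agree_card_gt0 S x : x \in C -> (0 < agree_card S x)%N.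
Proof. by move=> xC; apply/card_gt0P; exists x; rewrite inE xC agree_refl. Qed.

Lemma agree_card_le S x : (agree_card S x <= #|C|)%N.
Proof. by apply: subset_leq_card; apply/fintype.subsetP => y; rewrite inE => /andP[]. Qed.

Lemma eq_agree_card S x y : agree S x y -> agree_card S x = agree_card S y.
Proof.
move=> xy; congr #|pred_of_set _|; apply/setP => z; rewrite !inE; congr andb.
by apply/idP/idP; apply: agree_trans; rewrite // agree_sym.
Qed.

(* [#|C|] times the Shannon entropy of the restriction to [S] of a uniformly
   random element of [C]. *)
Definition entropy S : R :=
  \sum_(x in C) (ln #|C|%:R - ln (agree_card S x)%:R).

Lemma entropy_ge0 S : 0 <= entropy S.
Proof.
apply: sumr_ge0 => x xC; rewrite subr_ge0.
by rewrite ler_ln ?posrE ?ltr0n ?ler_nat ?agree_card_le ?agree_card_gt0 //;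
  apply/card_gt0P; exists x.
Qed.

Lemma ln_le_subr1 (a : R) : 0 < a -> ln a <= a - 1.
Proof.
move=> a0; have := @le_ln1Dx R (a - 1); rewrite addrCA subrr addr0; apply; lra.
Qed.

(* Expand the numerator as a sum over [y] agreeing with [x] on [S] and [z] agreeing
   with [x] on [T].  For fixed [y] and [z], which then agree on [S :&: T], the
   possible [x] lie in a single agreement class of [S :|: T]. *)
Lemma sum_agree_card_ratio S T :
  \sum_(x in C) ((agree_card S x)%:R * (agree_card T x)%:R /
    ((agree_card (S :|: T) x)%:R * (agree_card (S :&: T) x)%:R)) <= #|C|%:R :> R.
Proof.
pose U := S :|: T; pose I := S :&: T.
pose w x : R := (agree_card U x)%:R^-1 * (agree_card I x)%:R^-1.
(* For fixed [y], exactly [agree_card I y] codewords [z] agree with it on [I], so each inner sum is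
   1. *)
have -> : #|C|%:R = \sum_(y in C) \sum_(z in C)
    (agree I y z)%:R * (agree_card I y)%:R^-1 :> R.
  rewrite -sum1_card natr_sum; apply: eq_bigr => y yC.
  by rewrite -mulr_suml -agree_cardE divff // pnatr_eq0 -lt0n agree_card_gt0.
have -> : \sum_(x in C) ((agree_card S x)%:R * (agree_card T x)%:R /
      ((agree_card U x)%:R * (agree_card I x)%:R)) =
    \sum_(y in C) \sum_(z in C) \sum_(x in C)
      (agree S x y && agree T x z)%:R * w x :> R.
  under [RHS]eq_bigr do rewrite exchange_big /=.
  rewrite exchange_big /=; apply: eq_bigr => x xC.
  rewrite !agree_cardE invfM -!agree_cardE -/(w x) !agree_cardE.
  rewrite mulr_suml mulr_suml; apply: eq_bigr => y yC.
  rewrite mulr_sumr mulr_suml; apply: eq_bigr => z zC.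
  by rewrite -mulnb natrM.
apply: ler_sum => y yC; apply: ler_sum => z zC.
have [x0 /andP[x0C /andP[x0y x0z]]|none] :=
  pickP (fun x => (x \in C) && (agree S x y && agree T x z)); last first.
  rewrite big1 => [|x xC]; first by rewrite mulr_ge0 ?invr_ge0 ?ler0n.
  by have := none x; rewrite xC /= => ->; rewrite mul0r.
have yz : agree I y z.
  apply: (@agree_trans _ x0).
    by rewrite agree_sym; apply: agree_sub x0y; exact: finset.subsetIl.
  by apply: agree_sub x0z; exact: finset.subsetIr.
rewrite yz mul1r.
have -> : (agree_card I y)%:R^-1 = \sum_(x in C)
    (agree U x0 x)%:R * ((agree_card U x0)%:R^-1 * (agree_card I y)%:R^-1) :> R.
  by rewrite -mulr_suml -agree_cardE mulrA divff ?mul1r // pnatr_eq0 -lt0n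
    agree_card_gt0.
apply: ler_sum => x xC.
case: (boolP (agree S x y && agree T x z)) => [/andP[xy xz]|_]; last first.
  by rewrite mul0r !mulr_ge0 ?invr_ge0.
have x0x : agree U x0 x.
  rewrite agreeU; apply/andP; split.
    by apply: agree_trans x0y _; rewrite agree_sym.
  by apply: agree_trans x0z _; rewrite agree_sym.
rewrite x0x !mul1r /w (eq_agree_card x0x) (@eq_agree_card I x y) //.
by apply: agree_sub xy; exact: finset.subsetIl.
Qed.

(** Left side minus right side is the sum of the logarithms of the ratios in [sum_agree_card_ratio];
    [ln a <= a - 1] bounds it by [#|C| - #|C|]. *)
Lemma entropy_submod S T :
  entropy (S :|: T) + entropy (S :&: T) <= entropy S + entropy T.
Proof.
rewrite /entropy -!big_split /= -subr_le0 -sumrB.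
apply: (@le_trans _ _ (\sum_(x in C) ((agree_card S x)%:R * (agree_card T x)%:R /
    ((agree_card (S :|: T) x)%:R * (agree_card (S :&: T) x)%:R) - 1))); last first.
  rewrite sumrB subr_le0 (le_trans (sum_agree_card_ratio S T)) //.
  by rewrite sumr_const.
apply: ler_sum => x xC.
have pos X : 0 < (agree_card X x)%:R :> R by rewrite ltr0n agree_card_gt0.
apply: le_trans (ln_le_subr1 _); last by rewrite divr_gt0 ?mulr_gt0.
rewrite ln_div ?posrE ?mulr_gt0 // !lnM ?posrE //; lra.
Qed.

(** Again by [ln a <= a - 1]: each value at [v] contributes at most 1 to the sum of the reciprocal
    class sizes, so that sum is at most [#|Q|]. *)
Lemma entropy_set1 v : entropy [set v] <= #|C|%:R * ln #|Q|%:R.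
Proof.
have [C0|[x0 x0C]] := set_0Vmem C; first by
  rewrite /entropy C0 cards0 mul0r big_set0.
have C0 : 0 < #|C|%:R :> R by rewrite ltr0n; apply/card_gt0P; exists x0.
have Q0 : 0 < #|Q|%:R :> R by rewrite ltr0n; apply/card_gt0P; exists (x0 v).
rewrite -subr_le0 mulr_natl -sumr_const -sumrB.
apply: (@le_trans _ _ (\sum_(x in C)
    (#|C|%:R / #|Q|%:R * (agree_card [set v] x)%:R^-1 - 1))).
  apply: ler_sum => x xC.
  have N0 : 0 < (agree_card [set v] x)%:R :> R by rewrite ltr0n agree_card_gt0.
  apply: le_trans (ln_le_subr1 _); last by rewrite !divr_gt0.
  rewrite !ln_div ?posrE ?divr_gt0 //; lra.
rewrite sumrB subr_le0 sumr_const -mulr_sumr.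
rewrite -mulrA ler_piMr ?ler0n // mulrC ler_pdivrMr // mul1r.
rewrite (partition_big (fun x : {ffun V -> Q} => x v) xpredT) //=.
rewrite -sum1_card natr_sum; apply: ler_sum => a _.
have [x1 /andP[x1C /eqP x1v]|none] := pickP [pred x in C | x v == a]; last first.
  by rewrite big_pred0 // => x; have := none x; rewrite inE.
have N0 : (agree_card [set v] x1)%:R != 0 :> R.
  by rewrite pnatr_eq0 -lt0n agree_card_gt0.
rewrite -[leRHS](divff N0) {1}agree_cardE mulr_suml big_mkcondr /=; apply: ler_sum => x xC.
case: eqP => xv; last by rewrite mulr_ge0 ?invr_ge0 ?ler0n.
have x1x : agree [set v] x1 x by apply/agreeP => u /set1P->; rewrite x1v.
by rewrite x1x mul1r (eq_agree_card x1x).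
Qed.

(** Each agreement class on [S] lies inside one on [T], so it is no larger. *)
Lemma entropy_determined S T :
  {in C &, forall x y, agree S x y -> agree T x y} -> entropy T <= entropy S.
Proof.
move=> ST; apply: ler_sum => x xC; rewrite lerD2l lerN2.
rewrite ler_ln ?posrE ?ltr0n ?agree_card_gt0 // ler_nat.
apply: subset_leq_card; apply/fintype.subsetP => y; rewrite !inE => /andP[yC xy].
by rewrite yC ST.
Qed.

Lemma entropy_full S : {in C &, forall x y, agree S x y -> x = y} ->
  entropy S = #|C|%:R * ln #|C|%:R.
Proof.
move=> S_inj; rewrite mulr_natl -sumr_const; apply: eq_bigr => x xC.
suff -> : agree_card S x = 1%N by rewrite ln1 subr0.
rewrite -(cards1 x); congr #|pred_of_set _|; apply/setP => y; rewrite !inE.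
apply/andP/eqP => [[yC xy]|->]; first by rewrite (S_inj x y).
by rewrite agree_refl.
Qed.

End Entropy.

(** Discarding [h (S :&: T) >= 0] turns submodularity into subadditivity. *)
Lemma submod_bigcup (R : realType) (V : finType) (h : {set V} -> R)
    (h_ge0 : forall S, 0 <= h S) (h0 : h finset.set0 <= 0)
    (h_submod : forall S T, h (S :|: T) + h (S :&: T) <= h S + h T)
    (I : finType) (P : pred I) (F : I -> {set V}) :
  h (\bigcup_(i | P i) F i)%SET <= \sum_(i | P i) h (F i).
Proof.
elim/big_rec2: _ => // i S a _ /(lerD (lexx (h (F i)))); apply: le_trans.
by apply: le_trans (h_submod _ _); rewrite lerDl.
Qed.

Lemma entropy_le_card (R : realType) (V Q : finType) (C : {set {ffun V -> Q}})
    (S : {set V}) :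
  entropy R C S <= #|C|%:R * ln #|Q|%:R * #|S|%:R.
Proof.
have e0 : entropy R C finset.set0 <= 0.
  rewrite /entropy big1 // => x xC; suff -> : agree_card C finset.set0 x = #|C|.
    by rewrite subrr.
  congr #|pred_of_set _|; apply/setP => y; rewrite inE andb_idr // => _.
  by apply/agreeP => v; rewrite inE.
have SE : (\bigcup_(v in S) [set v])%SET = S.
  apply/setP => v; apply/bigcupP/idP => [[u uS /set1P->//]|vS].
  by exists v; rewrite ?inE.
rewrite -{1}SE mulr_natr -sumr_const.
apply: le_trans (submod_bigcup (entropy_ge0 R C) e0 (entropy_submod R C) _ _) _.
by apply: ler_sum => v _; exact: entropy_set1.
Qed.

(** * The LP bound for submodular functions *)

Section LPBound.
Variables (R : realType) (V : finType) (e : rel V) (tau : nat).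
Implicit Type chi : gadget V tau -> bool -> bool.

(* The parts of a given color form a vertex cover [U], so [h U >= H] bounds the
   total [h] of that color; the two parts of a gadget together have [h] at most
   [h (cl A) + h (cl B) <= m * (#|A| + #|B|)]. *)
Lemma lp_weight_ge (h : {set V} -> R) (m H : R) chi
    (h_ge0 : forall S, 0 <= h S)
    (h_submod : forall S T, h (S :|: T) + h (S :&: T) <= h S + h T)
    (h_cl : forall A, h (cl e A) <= h A)
    (h_card : forall A, h A <= m * #|A|%:R)
    (h_cover : forall U : {set V},
       (forall u v, e u v -> (u \in U) || (v \in U)) -> H <= h U) :
  lp_feasible R e chi -> tau%:R * H <= m * lp_weight R chi.
Proof.
move=> [_ cover chiE].
have h0 : h finset.set0 <= 0 by have := h_card finset.set0; rewrite cards0 mulr0.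
pose sel (c : 'I_tau) (gb : gadget V tau * bool) :=
  chi gb.1 gb.2 && (gcolor gb.1 gb.2 == c).
pose U c := (\bigcup_(gb | sel c gb) gpart e gb.1 gb.2)%SET.
have U_cover c u v : e u v -> (u \in U c) || (v \in U c).
  move=> uv; have := cover u v uv c.
  have in_U w : (0 < lp_cover e chi w c)%N -> w \in U c.
    apply: contraTT => wU; rewrite -leqNgt leqn0 sum_nat_eq0; apply/forallP => g.
    apply/implyP => _; rewrite sum_nat_eq0; apply/forallP => b.
    apply/implyP => /andP[wg gc]; rewrite eqb0; apply: contra wU => gb.
    by apply/bigcupP; exists (g, b) => //; rewrite /sel /= gb.
  by rewrite addn_gt0 => /orP[/in_U->|/in_U->]; rewrite ?orbT.
have gpart_le g : h (gpart e g true) + h (gpart e g false) <=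
    m * (gweight g)%:R.
  case: g => [[[A B]|v] cs]; rewrite /gpart /gweight /=.
    apply: le_trans (h_submod _ _) _; rewrite natrD mulrDr lerD //.
      exact: le_trans (h_cl _) (h_card _).
    exact: le_trans (h_cl _) (h_card _).
  by rewrite -[leRHS]addr0 lerD // -(cards1 v).
apply: (@le_trans _ _ (\sum_(c : 'I_tau) h (U c))).
  rewrite mulr_natl -[X in H *+ X]card_ord -sumr_const.
  by apply: ler_sum => c _; apply: h_cover; exact: U_cover.
apply: (@le_trans _ _ (\sum_(c : 'I_tau) \sum_(gb | sel c gb)
    h (gpart e gb.1 gb.2))).
  by apply: ler_sum => c _; exact: submod_bigcup.
(* Each selected part has exactly one color, so the double sum runs once over all selected parts. *)
rewrite -(partition_big (fun gb => gcolor gb.1 gb.2) xpredT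
    (P := fun gb => chi gb.1 gb.2)) //=.
rewrite big_mkcond /= -(pair_bigA _ (fun g b =>
  if chi g b then h (gpart e g b) else 0)) /= mulr_sumr.
apply: ler_sum => g _; rewrite !big_bool /= -chiE.
case: (chi g true); last by rewrite !mul0r addr0 mulr0.
by rewrite !mul1r -splitr.
Qed.

(** Makes the infimum in [lp_bound] one over a nonempty set. *)
Lemma lp_feasible_all : (0 < tau)%N -> lp_feasible R e (fun (_ : gadget V tau) _ => true).
Proof.
move=> tau0; split=> //.
  have -> : lp_weight R (fun (_ : gadget V tau) _ => true) =
      (\sum_(g : gadget V tau) gweight g)%:R.
    rewrite natr_sum; apply: eq_bigr => g _.
    by rewrite big_bool /= !mul1r -splitr.
  (* Weights ignore colors, so all [tau * tau] color pairs contribute equally and the total is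
     divisible by [tau]. *)
  rewrite -(pair_bigA _ (fun a cs => gweight ((a, cs) : gadget V tau))) /=.
  have -> : (\sum_a \sum_(cs : 'I_tau * 'I_tau)
      gweight ((a, cs) : gadget V tau) =
      tau * \sum_a (tau * gweight ((a, (Ordinal tau0, Ordinal tau0)) : gadget V tau)))%N.
    rewrite big_distrr; apply: eq_bigr => a _ /=.
    by rewrite sum_nat_const card_prod card_ord mulnA.
  by rewrite natrM mulKf ?pnatr_eq0 -?lt0n // natr_nat.
move=> u v _ c; rewrite addn_gt0; apply/orP; left.
(* The outside of the trivial gadget at [u] colored [c] suffices. *)
rewrite /lp_cover (bigD1 ((inr u, (c, c)) : gadget V tau)) //= addn_gt0.
apply/orP; left; rewrite big_mkcond big_bool /= /gpart /gcolor /=.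
by rewrite inE !eqxx.
Qed.

End LPBound.

(** * Storage codes and the LP bound along a homomorphism *)

Lemma storage_codeP (V Q : finType) (e : rel V) (C : {set {ffun V -> Q}}) :
  storage_code e C <-> C != finset.set0 /\
    forall v, {in C &, forall x y, agree (nbr e v) x y -> x v = y v}.
Proof.
split=> -[C0 rec]; split=> // v.
  have [f fE] := rec v => x y xC yC /agreeP xy; rewrite !fE //; congr f.
  by apply/ffunP => -[u uN]; rewrite !ffunE xy.
have /set0Pn[x0 x0C] := C0.
pose res (x : {ffun V -> Q}) : {ffun {u : V | u \in nbr e v} -> Q} :=
  [ffun u => x (val u)].
(* Any codeword with the given restriction serves; [x0 v] is the default for restrictions that no
   codeword has. *)
exists (fun g => if [pick y in C | res y == g] is Some y then y v else x0 v).
move=> x xC; case: pickP => [y /andP[yC /eqP yx]|/(_ x)]; last first.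
  by rewrite xC /= eqxx.
apply: rec => //; apply/agreeP => u uN.
by have /ffunP/(_ (Sub u uN)) := yx; rewrite !ffunE /=.
Qed.

Section Rate.
Variables (R : realType) (V W Q : finType) (e : rel V) (e' : rel W).
Variables (p : W -> V) (m : nat) (C : {set {ffun W -> Q}}).

(** [lp_weight_ge] applied to the entropy of preimages under [p]; the scaling factor [#|C|] of
    [entropy] cancels. *)
Lemma storage_code_lp (tau : nat) (chi : gadget V tau -> bool -> bool)
    (p_hom : forall w w', e' w w' -> e (p w) (p w'))
    (p_fib : forall S : {set V}, #|p @^-1: S| = (m * #|S|)%N) :
  storage_code e' C -> lp_feasible R e chi ->
  tau%:R * ln #|C|%:R <= m%:R * ln #|Q|%:R * lp_weight R chi.
Proof.
move=> /storage_codeP[C0 rec] feas.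
have Cpos : 0 < #|C|%:R :> R by rewrite ltr0n card_gt0.
rewrite -(ler_pM2l Cpos) mulrCA [leRHS]mulrA.
pose h (S : {set V}) := entropy R C (p @^-1: S).
apply: (lp_weight_ge (h := h)) feas => [S|S T|A|A|U U_cover].
- exact: entropy_ge0.
- by rewrite /h preimsetU preimsetI entropy_submod.
(* If all neighbors of [p w] are in [A], those of [w] are in its preimage, so [w] is recovered from
   it. *)
- apply: entropy_determined => x y xC yC /agreeP xy; apply/agreeP => w.
  rewrite !inE => /orP[pA|/fintype.subsetP NA]; first by apply: xy; rewrite inE.
  apply: rec => //; apply/agreeP => w'; rewrite inE => /p_hom ww'.
  by apply: xy; rewrite inE NA // inE.
- rewrite (le_trans (entropy_le_card _ _ _)) // p_fib natrM.
  by rewrite [in leRHS](mulrC m%:R) !mulrA.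
(* A vertex outside the preimage of a cover has all its neighbors inside. *)
rewrite /h entropy_full // => x y xC yC /agreeP xy; apply/ffunP => w.
have [wU|wU] := boolP (p w \in U); first by apply: xy; rewrite inE.
apply: rec => //; apply/agreeP => w'; rewrite inE => /p_hom /U_cover.
by rewrite (negPf wU) /= => w'U; apply: xy; rewrite inE.
Qed.

Lemma rate_le_lp_bound (tau : nat)
    (p_hom : forall w w', e' w w' -> e (p w) (p w'))
    (p_fib : forall S : {set V}, #|p @^-1: S| = (m * #|S|)%N) :
  (0 < tau)%N -> (1 < #|Q|)%N -> (0 < #|W|)%N -> storage_code e' C ->
  rate R #|Q| C <= lp_bound R e tau.
Proof.
move=> tau0 Q1 W0 codeC; apply: lb_le_inf.
  exists ((#|V|%:R * tau%:R)^-1 * lp_weight R (fun (_ : gadget V tau) _ => true)).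
  by exists (fun _ _ => true) => //; exact: lp_feasible_all.
move=> _ [chi feas <-]; have := storage_code_lp p_hom p_fib codeC feas.
have WE : #|W| = (m * #|V|)%N.
  by rewrite -(cardsT V) -p_fib preimsetT cardsT.
have lnQ : 0 < ln #|Q|%:R :> R by rewrite ln_gt0 // ltr1n.
have [m0 V0] : (0 < m /\ 0 < #|V|)%N.
  by apply/andP; rewrite -muln_gt0 -WE.
have mR : 0 < m%:R :> R by rewrite ltr0n.
have VR : 0 < #|V|%:R :> R by rewrite ltr0n.
have tR : 0 < tau%:R :> R by rewrite ltr0n.
move=> le_w; rewrite /rate WE natrM mulrC -mulrA -invfM ler_pdivrMr ?mulr_gt0 //.
rewrite invfM mulrC -(ler_pM2l tR) (le_trans le_w) // le_eqVlt.
apply/orP; left; apply/eqP; field.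
by rewrite !gt_eqF.
Qed.

End Rate.

(** * The interleaved code *)

Definition partition_mx (k s : nat) (A : 'M[nat]_(k, s)) : Prop :=
  forall m, (1 <= m <= k * s)%N -> exists! p : 'I_k * 'I_s, A p.1 p.2 = m.

(* By counting: the [k * s] required entries already fill all positions. *)
Lemma partition_mx_range (k s : nat) (A : 'M[nat]_(k, s)) i j :
  partition_mx A -> (1 <= A i j <= k * s)%N.
Proof.
move=> partA.
have /choice[f fE] (m : 'I_(k * s)) : exists p : 'I_k * 'I_s, A p.1 p.2 = m.+1.
  by have [|p [pm _]] := partA m.+1; [exact: ltn_ord | exists p].
have f_inj : injective f.
  by move=> m m' /(congr1 (fun p => A p.1 p.2)); rewrite !fE => -[/val_inj].
have /codomP[m ijm] : (i, j) \in codom f.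
  by apply: inj_card_onto => //; rewrite card_prod !card_ord.
by have := fE m; rewrite -ijm /= => ->; exact: ltn_ord.
Qed.

Section Interleaved.
Variables (V Q : finType) (e : rel V) (C : {set {ffun V -> Q}}).
Variables (k s ncol : nat) (c : V -> 'I_ncol) (M : 'I_ncol -> 'M[nat]_(k, s)).
Hypothesis M_part : forall i, partition_mx (M i).

Lemma interleaved_codeP y : reflect
  (exists2 x : nat -> {ffun V -> Q},
    forall m, (1 <= m <= k * s)%N -> x m \in C & y = interleaved_word c M x)
  (y \in interleaved_code c M C).
Proof. by rewrite inE; exact: asboolP. Qed.

(** Entry [i] at [(t, mu)] is the coordinate [t] of the codeword of index [m = M (c t) i mu]. For
    each neighbor [t'] of [t], the column of [M (c t')] containing [m] gives a neighbor [(t', mu')]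
    storing the coordinate [t'] of the same codeword, so recovery in [C] applies. *)
Lemma interleaved_storage_code :
  storage_code e C -> storage_code (interleaved_graph e c M) (interleaved_code c M C).
Proof.
move=> /storage_codeP[/set0Pn[x0 x0C] rec]; apply/storage_codeP; split.
  apply/set0Pn; exists (interleaved_word c M (fun _ => x0)).
  by apply/interleaved_codeP; exists (fun _ => x0).
move=> [t mu] _ _ /interleaved_codeP[x xC ->] /interleaved_codeP[y yC ->].
move=> /agreeP xy; rewrite !ffunE; apply/ffunP => i; rewrite !ffunE /=.
set m := M (c t) i mu.
have m_range : (1 <= m <= k * s)%N by exact: partition_mx_range.
apply: rec; [exact: xC | exact: yC | apply/agreeP => t'; rewrite inE => tt'].
have [[i' mu'] [/= m_at _]] := M_part (c t') m_range.
have := xy (t', mu'); rewrite !ffunE inE /interleaved_graph /= tt' /=.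
have -> : cols_meet (M (c t)) (M (c t')) mu mu'.
  by apply/hasP; exists m; apply/mapP; [exists i | exists i'; rewrite ?m_at];
    rewrite ?mem_enum.
by move=> /(_ isT) /ffunP/(_ i'); rewrite !ffunE /= m_at.
Qed.

(** Interleaving is injective on families: each coordinate of each codeword is stored somewhere. *)
Lemma card_interleaved_code : C != finset.set0 ->
  (#|C| ^ (k * s) <= #|interleaved_code c M C|)%N.
Proof.
move=> /set0Pn[x0 x0C].
(* Matrix entries start at 1 and ordinals at 0, hence [m.-1]; [x0] fills the indices above
   [k * s]. *)
pose fam (X : {ffun 'I_(k * s) -> {ffun V -> Q}}) m :=
  if insub m.-1 is Some i then X i else x0.
have famE X (i : 'I_(k * s)) : fam X i.+1 = X i by rewrite /fam /= valK.
rewrite -[X in (_ ^ X)%N]card_ord -card_ffun_on.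
rewrite -(card_in_imset (f := fun X => interleaved_word c M (fam X))).
  apply: subset_leq_card; apply/fintype.subsetP => _ /imsetP[X /ffun_onP XC ->].
  apply/interleaved_codeP; exists (fam X) => // m _.
  by rewrite /fam; case: insubP.
move=> X Y _ _ XY; apply/ffunP => m; apply/ffunP => v.
have [[i mu] [/= m_at _]] := M_part (c v) (ltn_ord m : 1 <= m.+1 <= _)%N.
have /ffunP/(_ (v, mu))/ffunP := XY; rewrite !ffunE => /(_ i).
by rewrite !ffunE /= m_at !famE.
Qed.

End Interleaved.

(** The exponent [k * s] in the size bound cancels against [s] times as many vertices and [ln] of
    the alphabet size multiplied by [k]. *)
Lemma rate_interleaved_code (R : realType) (V Q : finType)
    (C : {set {ffun V -> Q}}) (k s ncol : nat) (c : V -> 'I_ncol)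
    (M : 'I_ncol -> 'M[nat]_(k, s)) :
  (1 < #|Q|)%N -> (0 < k)%N -> (0 < s)%N -> C != finset.set0 ->
  (forall i, partition_mx (M i)) ->
  rate R #|Q| C <= rate R (#|Q| ^ k) (interleaved_code c M C).
Proof.
move=> Q1 k0 s0 C0 M_part.
have CR : 0 < #|C|%:R :> R by rewrite ltr0n card_gt0.
have lnQ : 0 < ln #|Q|%:R :> R by rewrite ln_gt0 // ltr1n.
have le_ln : (k * s)%:R * ln #|C|%:R <= ln #|interleaved_code c M C|%:R :> R.
  have C_le := card_interleaved_code c M_part C0.
  have Ck0 : (0 < #|C| ^ (k * s))%N by rewrite expn_gt0 card_gt0 C0.
  by rewrite mulr_natl -lnXn // -natrX ler_ln ?posrE ?ltr0n ?ler_nat // (leq_trans Ck0).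
have [kR sR] : 0 < k%:R :> R /\ 0 < s%:R :> R by rewrite !ltr0n.
rewrite /rate card_prod card_ord natrX lnXn ?ltr0n ?(ltnW Q1) //.
rewrite natrM invfM -mulrA ler_wpM2l ?invr_ge0 ?ler0n //.
rewrite -[_ *+ k]mulr_natl mulrCA -invfM ler_pdivlMr ?mulr_gt0 // (le_trans _ le_ln) //.
by rewrite natrM le_eqVlt; apply/orP; left; apply/eqP; field; rewrite gt_eqF.
Qed.

(** * Capacities under a uniform bound on rates *)

Section Capacity.
Variables (R : realType) (V : finType) (e : rel V) (L : R).
Hypothesis rate_le : forall (Q : finType) (C : {set {ffun V -> Q}}),
  (1 < #|Q|)%N -> storage_code e C -> rate R #|Q| C <= L.

Lemma cap_q_le q : (1 < q)%N -> cap_q R e q <= L.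
Proof.
move=> q1; apply: ge_sup => [|_ [Q [C [Qq codeC ->]]]]; last first.
  by subst q; exact: rate_le.
(* A code with a single constant word shows that the set of rates is nonempty. *)
exists (rate R q [set [ffun _ : V => Ordinal (ltnW q1)]]%SET).
exists 'I_q, [set [ffun _ : V => Ordinal (ltnW q1)]]%SET; split=> //.
  exact: card_ord.
apply/storage_codeP; split; first by apply/set0Pn; exists [ffun=> Ordinal (ltnW q1)]; rewrite inE.
by move=> v x y /set1P-> /set1P->.
Qed.

Lemma rate_le_cap_q (Q : finType) (C : {set {ffun V -> Q}}) q :
  (1 < q)%N -> #|Q| = q -> storage_code e C -> rate R q C <= cap_q R e q.
Proof.
move=> q1 Qq codeC; apply: ub_le_sup; last by exists Q, C.
by exists L => _ [Q' [C' [Qq' codeC' ->]]]; subst q; rewrite -Qq'; apply: rate_le; rewrite ?Qq'.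
Qed.

Lemma cap_q_le_cap q : (1 < q)%N -> cap_q R e q <= cap R e.
Proof.
move=> q1; apply: ub_le_sup; last by exists q.
by exists L => _ [q' q'1 <-]; exact: cap_q_le.
Qed.

Lemma cap_le : cap R e <= L.
Proof.
apply: ge_sup => [|_ [q q1 <-]]; last exact: cap_q_le.
by exists (cap_q R e 2), 2%N.
Qed.

End Capacity.

Theorem proposition3p7 (R : realType)
    (n : nat) (n_gt0 : (0 < n)%N)
    (e : rel 'I_n) (e_loopless : irreflexive e)
    (Q : finType) (Q_ge2 : (2 <= #|Q|)%N)
    (C : {set {ffun 'I_n -> Q}})
    (C_storage : storage_code e C)
    (C_optimal : rate R #|Q| C = cap_q R e #|Q|)
    (k s : nat) (k_ge1 : (1 <= k)%N) (k_le_s : (k <= s)%N)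
    (F : set 'M[nat]_(k, s)) (F_orth : orthogonal_partitions F)
    (ncol : nat) (c : 'I_n -> 'I_ncol) (c_proper : proper_coloring e c)
    (M : 'I_ncol -> 'M[nat]_(k, s)) (M_F : forall i : 'I_ncol, F (M i))
    (M_inj : injective M)
    (lp_achieved : exists tau : nat,
       (0 < tau)%N /\ cap_q R e #|Q| = lp_bound R e tau) :
  rate R (#|Q| ^ k)%N (interleaved_code c M C) = cap R (interleaved_graph e c M)
  /\ cap_q R (interleaved_graph e c M) (#|Q| ^ k)%N = cap R e.
Proof.
have [tau [tau0 lpE]] := lp_achieved.
have s0 : (0 < s)%N := leq_trans k_ge1 k_le_s.
have M_part i : partition_mx (M i) by have [+ _] := F_orth; apply; exact: M_F.
have leG (Q' : finType) (C' : {set {ffun 'I_n -> Q'}}) :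
    (1 < #|Q'|)%N -> storage_code e C' -> rate R #|Q'| C' <= lp_bound R e tau.
  move=> Q'1; apply: (rate_le_lp_bound R (p := id) (m := 1)) => //; last by rewrite card_ord.
  by move=> S; rewrite mul1n; apply: eq_card => v; rewrite inE.
have leI (Q' : finType) (C' : {set {ffun 'I_n * 'I_s -> Q'}}) :
    (1 < #|Q'|)%N -> storage_code (interleaved_graph e c M) C' ->
    rate R #|Q'| C' <= lp_bound R e tau.
  (* The fibers of the projection are copies of ['I_s]. *)
  move=> Q'1; apply: (rate_le_lp_bound R (p := fst) (m := s)) => //.
  - by move=> w w' /andP[].
  - move=> S; rewrite mulnC -[X in (_ * X)%N]card_ord -cardsT -cardsX.
    by apply: eq_card => w; rewrite !inE andbT.
  by rewrite card_prod !card_ord muln_gt0 n_gt0.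
have qk1 : (1 < #|Q| ^ k)%N by rewrite -(expn0 #|Q|) ltn_exp2l.
have codeI := interleaved_storage_code c M_part C_storage.
have [C0 _] := C_storage.
have rateI := rate_interleaved_code R c Q_ge2 k_ge1 s0 C0 M_part.
have qkE : #|{ffun 'I_k -> Q}| = (#|Q| ^ k)%N by rewrite card_ffun card_ord.
have rate_cap := rate_le_cap_q leI qk1 qkE codeI.
have cap_q_capI := cap_q_le_cap leI qk1.
have capI_le := cap_le leI.
have cap_q_capG := cap_q_le_cap leG Q_ge2.
have capG_le := cap_le leG.
(* The rate of [C] is at most that of the interleaved code, then [cap_q], then [cap] of the
   interleaved graph, then [lp_bound], which equals the rate of [C]; [cap R e] lies between
   [cap_q R e #|Q|] and [lp_bound]. *)
split; apply/eqP; rewrite eq_le; apply/andP; split; lra.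
Qed.
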